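(* Let $\alpha,\varepsilon>0$ and let $\mathcal{D}$ be an unknown $(\varepsilon/4,R)$-concentrated distribution on $\mathbb{R}^n$. There exists a one-sided error tester making $O\!\left(\frac{1}{\varepsilon}\log\frac{1}{\varepsilon}\right)$ queries to $f:\mathbb{R}^n\to\mathbb{R}$ which distinguishes (with probability at least $2/3$) between the case when $f$ is pointwise $\alpha$-close to some additive function, and the case when for every additive function $h:\mathbb{R}^n\to\mathbb{R}$, $\Pr_{\mathbf{p}\sim\mathcal{D}}[|f(\mathbf{p})-h(\mathbf{p})|>C\,R\,n^{1.5}\alpha]>\varepsilon$, for a suitable absolute constant $C$.
   Context: A function $h:\mathbb{R}^n\to\mathbb{R}$ is additive if $h(\mathbf{x}+\mathbf{y})=h(\mathbf{x})+h(\mathbf{y})$ for all $\mathbf{x},\mathbf{y}\in\mathbb{R}^n$. $f$ is pointwise $\alpha$-close to $h$ if $|f(\mathbf{p})-h(\mathbf{p})|\leq\alpha$ for all $\mathbf{p}\in\mathbb{R}^n$. A distribution $\mathcal{D}$ is $(\varepsilon,R)$-concentrated if $\Pr_{\mathbf{p}\sim\mathcal{D}}[\|\mathbf{p}\|_2<R]\geq 1-\varepsilon$. The tester has query access to $f$ and sample access to $\mathcal{D}$ (and its own randomness, e.g. standard Gaussian samples); one-sided error means it accepts with probability $1$ in the first case, and it rejects with probability at least $2/3$ in the second case.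
   Formalization: It is assumed that n ≥ 1 and R·n^{1.5} ≥ 1 (for small R the claim fails: D the point mass at 0, f the constant α), and f is taken Borel measurable in the rejection case so that the probabilities are defined. *)

(* Defs.v *)
From HB Require Import structures.
From mathcomp Require Import all_boot all_order all_algebra.
From mathcomp Require Import all_classical all_reals all_analysis.

Set Implicit Arguments.
Unset Strict Implicit.
Unset Printing Implicit Defensive.

Import Order.TTheory GRing.Theory Num.Theory.

Local Open Scope classical_set_scope.
Local Open Scope ring_scope.

(* R^n is 'rV[R]_n. The norm carried by 'rV[R]_n in the library is the maximum
   norm, so the Euclidean norm is defined separately; the sigma-algebra, that
   the library does not provide, is the product (= Borel) one, generated by the
   coordinate maps exactly as for n.-tuple R. *)

Definition rV_display : measure_display -> measure_display.
Proof. exact. Qed.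

Section measurable_rV.
Context {d} {T : sigmaRingType d}.
Variable n : nat.

Let coord (i : 'I_n) (x : 'rV[T]_n) : T := x ord0 i.

Let rV_set0 : g_sigma_preimage coord set0.
Proof. exact: sigma_algebra0. Qed.

Let rV_setC A : g_sigma_preimage coord A -> g_sigma_preimage coord (~` A).
Proof. exact: sigma_algebraC. Qed.

Let rV_bigcup (F : (set 'rV[T]_n)^nat) :
  (forall i, g_sigma_preimage coord (F i)) ->
  g_sigma_preimage coord (\bigcup_i (F i)).
Proof. exact: sigma_algebra_bigcup. Qed.

HB.instance Definition _ := @isMeasurable.Build (rV_display d)
  'rV[T]_n (g_sigma_preimage coord) rV_set0 rV_setC rV_bigcup.

End measurable_rV.

Definition norm2 (R : realType) (n : nat) (x : 'rV[R]_n) : R :=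
  Num.sqrt (\sum_(i < n) x ord0 i ^+ 2).

Definition additive_fun (R : realType) (n : nat) (h : 'rV[R]_n -> R) : Prop :=
  forall x y, h (x + y) = h x + h y.

Definition pointwise_close (R : realType) (n : nat) (a : R)
    (f h : 'rV[R]_n -> R) : Prop :=
  forall p, `|f p - h p| <= a.

Definition concentrated (R : realType) (n : nat) (e r : R)
    (D : probability 'rV[R]_n R) : Prop :=
  ((1 - e)%:E <= D [set p | (norm2 p < r)%R])%E.

(* The law of m independent samples from D. *)

Section iid.
Context {d} {T : measurableType d} {R : realType}.

Definition tuple_cons (m : nat) (x : T * m.-tuple T) : m.+1.-tuple T :=
  [tuple of x.1 :: x.2].

Let measurable_tuple_cons m : measurable_fun setT (@tuple_cons m).
Proof. exact: measurable_cons. Qed.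

HB.instance Definition _ m := isMeasurableFun.Build _ _ _ _
  (@tuple_cons m) (@measurable_tuple_cons m).

Fixpoint iid (D : probability T R) (m : nat) : probability (m.-tuple T) R :=
  match m with
  | 0 => \d_([tuple] : 0.-tuple T)
  | m'.+1 => distribution (D \x iid D m')%E (@tuple_cons m')
  end.

Lemma iid_rect (D : probability T R) (m : nat) (B : 'I_m -> set T) :
  (forall i, measurable (B i)) ->
  iid D m [set t | forall i, B i (tnth t i)] = (\prod_(i < m) D (B i))%E.
Proof.
elim: m B => [|m IH] B mB /=.
  by rewrite big_ord0 diracE mem_set//= => -[].
rewrite big_ord_recl -IH; last by move=> i; exact: mB.
have mA : measurable
    [set t : m.-tuple T | forall i, B (lift ord0 i) (tnth t i)].
  rewrite [X in measurable X](_ : _ = \bigcap_(i in [set: 'I_m])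
    ((fun t : m.-tuple T => tnth t i) @^-1` B (lift ord0 i))); last first.
    apply/seteqP; split=> t /= H; first by move=> i _; exact: H.
    by move=> i; exact: (H i I).
  apply: fin_bigcap_measurable => // i _.
  by rewrite -[X in measurable X]setTI; exact: measurable_tnth.
rewrite -product_measure1E//; congr (product_measure1 _ _ _).
apply/seteqP; split=> -[x t] /=.
  by move=> H; split=> [|i]; [exact: (H ord0)|have := H (lift ord0 i); rewrite tnthS].
move=> [Bx H] i; case: (unliftP ord0 i) => [j|] ->; first by rewrite tnthS.
by [].
Qed.

End iid.

(* A deterministic adaptive query algorithm: each query may depend on the
   answers to the previous ones. *)

Inductive query_tree (X Y : Type) : Type :=
| Output (accept : bool)
| Query (x : X) (next : Y -> query_tree X Y).

Fixpoint accepts (X Y : Type) (f : X -> Y) (t : query_tree X Y) : bool :=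
  match t with
  | Output b => b
  | Query x next => accepts f (next (f x))
  end.

Fixpoint queries (X Y : Type) (f : X -> Y) (t : query_tree X Y) : nat :=
  match t with
  | Output _ => 0
  | Query x next => (queries f (next (f x))).+1
  end.

(* A tester draws its internal randomness from tester_law, independently draws
   nsamples independent samples from D, and then runs on f the query tree
   determined by these draws. The last field says that its answer is a random
   variable as soon as f is Borel. *)

Record tester (R : realType) (n : nat) := Tester {
  tester_display : measure_display;
  tester_space : measurableType tester_display;
  tester_law : probability tester_space R;
  nsamples : nat;
  tester_run : tester_space * nsamples.-tuple 'rV[R]_n ->
    query_tree 'rV[R]_n R;
  measurable_tester_run : forall f : 'rV[R]_n -> R,
    measurable_fun setT f -> measurable [set w | accepts f (tester_run w)]
}.

Arguments tester_run {R n} T w : rename.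

Definition run_law (R : realType) (n : nat) (T : tester R n)
    (D : probability 'rV[R]_n R) :
    probability (tester_space T * (nsamples T).-tuple 'rV[R]_n)%type R :=
  (tester_law T \x iid D (nsamples T))%E.

(* Being almost sure, this needs no measurability of f. *)
Definition accepts_as (R : realType) (n : nat) (T : tester R n)
    (D : probability 'rV[R]_n R) (f : 'rV[R]_n -> R) : Prop :=
  {ae run_law T D, forall w, accepts f (tester_run T w)}.

Definition reject_prob (R : realType) (n : nat) (T : tester R n)
    (D : probability 'rV[R]_n R) (f : 'rV[R]_n -> R) : \bar R :=
  run_law T D [set w | ~~ accepts f (tester_run T w)].

(* f differs by more than t from every additive function with D-probability
   more than e. An additive h can be non-measurable: only those for which the
   event has a probability are considered. *)
Definition far_from_additive (R : realType) (n : nat) (e t : R)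
    (D : probability 'rV[R]_n R) (f : 'rV[R]_n -> R) : Prop :=
  forall h : 'rV[R]_n -> R, additive_fun h ->
    measurable [set p | t < `|f p - h p|] ->
    (e%:E < D [set p | (t < `|f p - h p|)%R])%E.

(* Main.v *)
From HB Require Import structures.
Require Import Defs.
From mathcomp Require Import all_boot all_order all_algebra.
From mathcomp Require Import all_classical all_reals all_analysis.
From mathcomp Require Import measurable_realfun ring lra.
Import Order.TTheory GRing.Theory Num.Theory.
Local Open Scope classical_set_scope.
Local Open Scope ring_scope.

Set Implicit Arguments.
Unset Strict Implicit.

(* Put a = 3 alpha. The only check made is |f(x + y) - f(x) - f(y)| <= a, which
   never fails when f is alpha-close to an additive function. It is made for
   160 pairs drawn from mu x mu, and for the pairs (x, p_j) with a single x
   drawn from mu and 12/eps samples p_j of D. Here mu is uniform on a cube so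
   large that translating it by any vector of [-s, s]^n, s = 2^n r, changes the
   probability of an event by at most 1/80.

   If a violation has (mu x mu)-probability more than 1/80, the 160 pairs reveal
   one. Otherwise f(x + p) - f(x) is, for every p in [-s, s]^n and most x,
   within 2a of a value g(p), and g is additive on that cube up to 6a. As f is
   measurable, g is bounded there, and therefore within O(n a) of a linear L.
   Halving the argument n times divides that error by 2^n, at the cost of one
   additional term O(a), so |g - L| = O(a) on [-r, r]^n with a constant that
   does not depend on n. If f is far from L, then some sample p_j lies in the
   ball with |f(p_j) - L(p_j)| large, and for most x the pair (x, p_j) is then
   a violation. *)

(** * Functions additive up to a constant on a cube *)

Definition cube (R : realType) (n : nat) (s : R) : set 'rV[R]_n :=
  [set x | forall i, `|x ord0 i| <= s].

Definition additive_within (R : realType) (n : nat) (s d : R)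
    (g : 'rV[R]_n -> R) : Prop :=
  forall x y, cube s x -> cube s y -> cube s (x + y) ->
    `|g (x + y) - g x - g y| <= d.

Lemma sub_cube (R : realType) (n : nat) (s t : R) :
  s <= t -> @cube R n s `<=` cube t.
Proof. by move=> st x xs i; exact: le_trans (xs i) st. Qed.

(* Doubling a point of [-s/2, s/2] doubles the value up to d, and every point
   of [-s, s] is within a translation by s or -s of [-s/2, s/2]; hence the
   supremum b of |h| satisfies b <= (b + d) / 2 + d. *)
Lemma bounded_additive_within_itv (R : realType) (s d : R) (h : R -> R) :
  0 < s ->
  (forall x y, `|x| <= s -> `|y| <= s -> `|x + y| <= s ->
    `|h (x + y) - h x - h y| <= d) ->
  (exists B, forall x, `|x| <= s -> `|h x| <= B) -> h s = 0 ->
  forall x, `|x| <= s -> `|h x| <= 3 * d.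
Proof.
move=> s0 hD [B hB] hs.
pose E := [set `|h x| | x in [set x | `|x| <= s]].
have supE : has_sup E.
  split; first by exists `|h 0|; exists 0 => //=; rewrite normr0 ltW.
  by exists B => _ [x xs <-]; exact: hB.
have leE x : `|x| <= s -> `|h x| <= sup E.
  by move=> xs; apply: ub_le_sup; [case: supE | exists x].
have half x : `|x| <= s / 2 -> `|h x| <= (sup E + d) / 2.
  move=> xs.
  have x1 : `|x| <= s by lra.
  have x2 : `|x + x| <= s by rewrite (le_trans (ler_normD _ _))//; lra.
  have := hD x x x1 x1 x2; have := leE _ x2.
  rewrite !ler_norml; lra.
have shift x : `|x| <= s -> `|h x| <= (sup E + d) / 2 + d.
  move=> xs; have d0 : 0 <= d.
    have o : `|0 : R| <= s by rewrite normr0 ltW.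
    by have := hD 0 0 o o; rewrite addr0 => /(_ o); apply: le_trans.
  have ss : `|s| <= s by rewrite gtr0_norm.
  have [xh|xh] := leP `|x| (s / 2); first by have := half _ xh; lra.
  have [x0|x0] := leP 0 x.
    rewrite ger0_norm// in xh xs.
    have y2 : `|x - s| <= s / 2 by rewrite ler_norml; lra.
    have y1 : `|x - s| <= s by lra.
    have := hD (x - s) s y1 ss; rewrite subrK ger0_norm// => /(_ xs).
    by have := half _ y2; rewrite hs subr0 !ler_norml; lra.
  rewrite ltr0_norm// in xh; have xs' := xs; rewrite ltr0_norm// in xs'.
  have y2 : `|x + s| <= s / 2 by rewrite ler_norml; lra.
  have y1 : `|x + s| <= s by lra.
  have := hD x s xs ss y1.
  by have := half _ y2; rewrite hs subr0 !ler_norml; lra.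
have : sup E <= (sup E + d) / 2 + d.
  by apply: ge_sup => [|_ [x xs <-]]; [case: supE | exact: shift].
by move=> b x xs; have := leE x xs; lra.
Qed.

(** Each doubling gives [|g p| <= (|g (2p)| + d) / 2], and an error [d] is preserved by
    [e -> (e + d) / 2], so the number of halvings does not enter the error. Starting in the cube of
    half-width [s / 2 ^+ k] keeps all the doubled points inside the cube of half-width [s]. *)
Lemma additive_within_halving (R : realType) (n : nat) (s d : R)
    (g : 'rV[R]_n -> R) : 0 <= s -> additive_within s d g ->
  forall k p, cube (s / 2 ^+ k) p ->
    `|g p| <= `|g ((2 ^+ k) *: p)| / 2 ^+ k + d.
Proof.
move=> s0 gD; have d0 : 0 <= d.
  have c0 : cube s (0 : 'rV[R]_n) by move=> i; rewrite mxE normr0.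
  have c00 : cube s (0 + 0 : 'rV[R]_n) by rewrite addr0.
  by apply: le_trans (gD 0 0 c0 c0 c00).
elim=> [|k IH] p pk; first by rewrite expr0 scale1r divr1; lra.
have k0 : (0 : R) < 2 ^+ k by rewrite exprn_gt0.
have E : s / 2 ^+ k.+1 + s / 2 ^+ k.+1 = s / 2 ^+ k.
  by rewrite exprS; field; rewrite gt_eqF.
have p2 : cube (s / 2 ^+ k) (p + p).
  move=> i; rewrite mxE (le_trans (ler_normD _ _))//.
  by have := pk i; lra.
have ks : s / 2 ^+ k <= s.
  by rewrite ler_pdivrMr// ler_peMr// exprn_ege1// ler1n.
have k1s : s / 2 ^+ k.+1 <= s.
  have : 0 <= s / 2 ^+ k.+1 by rewrite divr_ge0// exprn_ge0.
  by move: ks; rewrite -E; lra.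
have p1 := sub_cube k1s pk.
have := gD p p p1 p1 (sub_cube ks p2).
have := IH _ p2.
have -> : 2 ^+ k *: (p + p) = 2 ^+ k.+1 *: p.
  by rewrite -{1 2}[p]scale1r -scalerDl scalerA exprSr.
set G := `|g (2 ^+ k.+1 *: p)|.
have -> : G / 2 ^+ k.+1 = (G / 2 ^+ k) / 2.
  by rewrite exprS; field; rewrite gt_eqF.
by set Z := G / 2 ^+ k; rewrite !ler_norml; case: (ger0P (g p)) => ?; lra.
Qed.

(** The point is built one coordinate at a time. Each coordinate costs [3 * d] for the value on its
    axis, by the one-dimensional bound, and [d] for adding it; the start [g 0] costs one more
    [d]. *)
Lemma bounded_additive_within_cube (R : realType) (n : nat) (s d : R)
    (g : 'rV[R]_n -> R) : 0 < s -> additive_within s d g ->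
  (exists B, forall x, cube s x -> `|g x| <= B) ->
  (forall i, g (s *: delta_mx ord0 i) = 0) ->
  forall x, cube s x -> `|g x| <= (4 * n%:R + 1) * d.
Proof.
move=> s0 gD [B gB] gs x xs.
have cd i t : `|t| <= s -> cube s (t *: delta_mx ord0 i).
  move=> ts j; rewrite !mxE eqxx/=; case: eqP => _; first by rewrite mulr1.
  by rewrite mulr0 normr0 ltW.
have axis i t : `|t| <= s -> `|g (t *: delta_mx ord0 i)| <= 3 * d.
  apply: (@bounded_additive_within_itv R s d
    (fun t => g (t *: delta_mx ord0 i))) => //.
    move=> a b sa sb sab; rewrite scalerDl; apply: gD; try exact: cd.
    by rewrite -scalerDl; exact: cd.
  by exists B => a sa; apply/gB/cd.
pose trunc k : 'rV[R]_n := \row_j (if (j < k)%N then x ord0 j else 0).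
have ct k : cube s (trunc k).
  by move=> j; rewrite mxE; case: ifP => _; [exact: xs|rewrite normr0 ltW].
have main k : (k <= n)%N -> `|g (trunc k)| <= (4 * k%:R + 1) * d.
  elim: k => [_|k IH kn].
    have -> : trunc 0%N = 0 by apply/rowP => j; rewrite !mxE.
    have c0 : cube s (0 : 'rV[R]_n) by move=> i; rewrite mxE normr0 ltW.
    have c00 : cube s (0 + 0 : 'rV[R]_n) by rewrite addr0.
    by have := gD 0 0 c0 c0 c00; rewrite addr0 subrr sub0r normrN; lra.
  pose i := Ordinal kn.
  have E : trunc k.+1 = trunc k + x ord0 i *: delta_mx ord0 i.
    apply/rowP => j; rewrite !mxE eqxx/= ltnS leq_eqVlt.
    have -> : (j == i) = (j == k :> nat) by [].
    case: eqP => jk /=; last by rewrite mulr0 addr0.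
    rewrite jk ltnn add0r mulr1; congr (x ord0 _); exact: val_inj.
  have := gD _ _ (ct k) (cd _ i _ (xs i)); rewrite -E => /(_ (ct k.+1)).
  have := IH (ltnW kn); have := axis i _ (xs i); rewrite -[k.+1%:R]natr1.
  have -> : (4 * (k%:R + 1) + 1) * d = (4 * k%:R + 1) * d + 4 * d by ring.
  by rewrite !ler_norml; lra.
suff -> : x = trunc n by exact: main.
by apply/rowP => j; rewrite mxE ltn_ord.
Qed.

(** The linear form interpolates [g] at the points [s *: delta_mx ord0 i]. The difference is still
    additive up to [d] and vanishes there, so the cube bound applies at [2 ^+ n *: p], and halving
    brings it back to [p]. *)
Lemma additive_within_linear (R : realType) (n : nat) (s d : R)
    (g : 'rV[R]_n -> R) : 0 < s -> 0 <= d -> additive_within s d g ->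
  (exists B, forall x, cube s x -> `|g x| <= B) ->
  exists c : 'I_n -> R, forall p, cube (s / 2 ^+ n) p ->
    `|g p - \sum_i p ord0 i * c i| <= 6 * d.
Proof.
move=> s0 d0 gD [B gB].
pose c i := g (s *: delta_mx ord0 i) / s.
pose L (p : 'rV[R]_n) := \sum_i p ord0 i * c i.
have LD x y : L (x + y) = L x + L y.
  by rewrite -big_split/=; apply: eq_bigr => i _; rewrite mxE mulrDl.
pose h p := g p - L p.
have hD : additive_within s d h.
  move=> x y xs ys xys; have := gD x y xs ys xys.
  rewrite /h LD; congr (`|_| <= d); ring.
have hs i : h (s *: delta_mx ord0 i) = 0.
  rewrite /h /L (bigD1 i)//= big1 => [|j ji].
    by rewrite !mxE !eqxx /= /c addr0 mulr1 mulrC divfK ?subrr// gt_eqF.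
  by rewrite !mxE (negbTE ji) andbF mulr0 mul0r.
have hB : exists B', forall x, cube s x -> `|h x| <= B'.
  exists (B + \sum_i s * `|c i|) => x xs.
  rewrite (le_trans (ler_normB _ _))// lerD ?gB//.
  rewrite (le_trans (ler_norm_sum _ _ _))// ler_sum// => i _.
  by rewrite normrM ler_wpM2r.
exists c => p ps.
have := additive_within_halving (ltW s0) hD ps.
rewrite -/(L p) -/(h p) => /le_trans; apply.
have n0 : (0 : R) < 2 ^+ n by rewrite exprn_gt0.
have cp : cube s (2 ^+ n *: p).
  move=> i; rewrite mxE normrM gtr0_norm// mulrC -ler_pdivlMr//.
have := bounded_additive_within_cube s0 hD hB hs cp => hp.
(* Hence [4 n + 1 <= 5 * 2 ^+ n]: the halvings absorb the factor linear in the dimension, and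
   [6 * d] is [5 * d] plus the halving error [d]. *)
have n2 : (n%:R + 1 : R) <= 2 ^+ n.
  by rewrite natr1 -natrX ler_nat ltn_expl.
have : `|h (2 ^+ n *: p)| / 2 ^+ n <= 5 * d.
  rewrite ler_pdivrMr// (le_trans hp)// [leRHS]mulrAC ler_wpM2r//.
  by have : (0 : R) <= n%:R by []; lra.
lra.
Qed.

(** * Product measures and quasi-invariance *)

Lemma measurable_coord d (T : measurableType d) (n : nat) (i : 'I_n) :
  measurable_fun setT (fun x : 'rV[T]_n => x ord0 i).
Proof.
move=> _ Y mY; rewrite setTI; apply: sub_sigma_algebra => /=.
rewrite -bigcup_seq/=; exists i => /=; first by rewrite mem_index_enum.
by exists Y => //; rewrite setTI.
Qed.

Lemma measurable_fun_rV d d' (T : measurableType d) (T' : measurableType d')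
    (n : nat) (f : T -> 'rV[T']_n) :
  (forall i, measurable_fun setT (fun x => f x ord0 i)) ->
  measurable_fun setT f.
Proof.
move=> mf; apply: (@measurability _ _ _ _ setT f
  (\big[setU/set0]_(i < n) preimage_set_system setT
     (fun x : 'rV[T']_n => x ord0 i) measurable)) => //.
move=> _ [B + <-]; rewrite -bigcup_seq => -[i _ [C mC <-]].
by rewrite !setTI; have := mf i measurableT _ mC; rewrite setTI.
Qed.

Lemma measurable_rV_add d (T : measurableType d) (R : realType) (n : nat)
    (f g : T -> 'rV[R]_n) : measurable_fun setT f -> measurable_fun setT g ->
  measurable_fun setT (fun x => f x + g x).
Proof.
move=> mf mg; apply: measurable_fun_rV => i.
under eq_fun do rewrite mxE.
by apply: measurable_funD;
  [exact: (measurableT_comp (measurable_coord i) mf)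
  |exact: (measurableT_comp (measurable_coord i) mg)].
Qed.

Section product_sections.
Context d1 d2 (T1 : measurableType d1) (T2 : measurableType d2) (R : realType).
Variables (P : probability T1 R) (Q : probability T2 R).
Local Open Scope ereal_scope.

Lemma product_le_xsection (A B : set (T1 * T2)) (c : R) :
  measurable A -> measurable B -> (0 <= c)%R ->
  (forall x, Q (xsection A x) <= Q (xsection B x) + c%:E) ->
  (P \x Q) A <= (P \x Q) B + c%:E.
Proof.
move=> mA mB c0 AB; rewrite /product_measure1.
apply: (@le_trans _ _ (\int[P]_x (Q (xsection B x) + c%:E))).
  apply: ge0_le_integral => //.
  - exact: measurable_fun_xsection.
  - by apply: emeasurable_funD => //; exact: measurable_fun_xsection.
  - by move=> x _; exact: AB.
rewrite (@ge0_integralD _ _ _ P _ measurableT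
  (fun x => Q (xsection B x)) (fun=> c%:E))//;
  last exact: measurable_fun_xsection.
by rewrite integral_cst//= probability_setT mule1.
Qed.

(** The two iterated integrals define measures that agree on rectangles, hence everywhere. *)
Lemma product_measure12 (A : set (T1 * T2)) : measurable A ->
  (P \x Q) A = \int[Q]_y P (ysection A y).
Proof.
move=> mA; rewrite -[RHS]/((P \x^ Q) A).
by apply: product_measure_unique => //= B C mB mC; rewrite product_measure2E.
Qed.

Lemma product_le_ysection (A B : set (T1 * T2)) (c : R) :
  measurable A -> measurable B -> (0 <= c)%R ->
  (forall y, P (ysection A y) <= P (ysection B y) + c%:E) ->
  (P \x Q) A <= (P \x Q) B + c%:E.
Proof.
move=> mA mB c0 AB; rewrite !product_measure12//.
apply: (@le_trans _ _ (\int[Q]_y (P (ysection B y) + c%:E))).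
  apply: ge0_le_integral => //.
  - exact: measurable_fun_ysection.
  - by apply: emeasurable_funD => //; exact: measurable_fun_ysection.
rewrite (@ge0_integralD _ _ _ Q _ measurableT
  (fun x => P (ysection B x)) (fun=> c%:E))//;
  last exact: measurable_fun_ysection.
by rewrite integral_cst//= probability_setT mule1.
Qed.

Lemma product_measureXT (A : set T1) : measurable A ->
  (P \x Q) (A `*` setT) = P A.
Proof.
by move=> mA; rewrite product_measure1E// [X in (_ * X)%E]probability_setT mule1.
Qed.

Lemma product_measureTX (B : set T2) : measurable B ->
  (P \x Q) (setT `*` B) = Q B.
Proof.
by move=> mB; rewrite product_measure1E// [X in (X * _)%E]probability_setT mul1e.
Qed.

(** Averaging: if all sections had mass above [c], so would their mean, up to equality. *)
Lemma exists_ysection_le (A : set (T1 * T2)) (c : R) :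
  measurable A -> (P \x Q) A < c%:E -> exists y, P (ysection A y) <= c%:E.
Proof.
move=> mA Ac; apply: contrapT => /forallNP H.
have c0 : (0 <= c)%R.
  by rewrite -lee_fin; apply: le_trans (ltW Ac); exact: measure_ge0.
suff : c%:E <= (P \x Q) A by rewrite leNgt Ac.
rewrite product_measure12// -[leLHS]mule1 -(probability_setT Q).
rewrite -(integral_cst Q)//; apply: ge0_le_integral => //.
- exact: measurable_fun_ysection.
- by move=> y _; have /negP := H y; rewrite -ltNge => /ltW.
Qed.

End product_sections.

(** Total variation distance at most [c] between [P] and its image under [phi]: the reverse
    inequality follows by taking complements. The error is additive so that it sums under
    composition. *)
Definition quasi_invariant d (T : measurableType d) (R : realType)
    (P : probability T R) (c : R) (phi : T -> T) : Prop :=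
  measurable_fun setT phi /\
  forall A, measurable A -> (P (phi @^-1` A) <= P A + c%:E)%E.

Lemma measurable_preimage d d' (T : measurableType d) (T' : measurableType d')
    (f : T -> T') (A : set T') :
  measurable_fun setT f -> measurable A -> measurable (f @^-1` A).
Proof. by move=> mf mA; have := mf measurableT _ mA; rewrite setTI. Qed.

Section quasi_invariant_product.
Context d1 d2 (T1 : measurableType d1) (T2 : measurableType d2) (R : realType).
Variables (P : probability T1 R) (Q : probability T2 R).

Lemma quasi_invariant_fst (c : R) (phi : T1 -> T1) : 0 <= c ->
  quasi_invariant P c phi ->
  quasi_invariant (P \x Q)%E c (fun z => (phi z.1, z.2)).
Proof.
move=> c0 [mphi phiP].
have m : measurable_fun setT (fun z : T1 * T2 => (phi z.1, z.2)).
  by apply: measurable_fun_pair => //; exact: measurableT_comp.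
split=> // A mA; apply: product_le_ysection => //.
  exact: measurable_preimage.
move=> y; rewrite !ysectionE; apply: (phiP (fun x => A (x, y))).
by have := measurable_ysection y mA; rewrite ysectionE.
Qed.

Lemma quasi_invariant_snd (c : R) (phi : T2 -> T2) : 0 <= c ->
  quasi_invariant Q c phi ->
  quasi_invariant (P \x Q)%E c (fun z => (z.1, phi z.2)).
Proof.
move=> c0 [mphi phiP].
have m : measurable_fun setT (fun z : T1 * T2 => (z.1, phi z.2)).
  by apply: measurable_fun_pair => //; exact: measurableT_comp.
split=> // A mA; apply: product_le_xsection => //.
  exact: measurable_preimage.
move=> x; rewrite !xsectionE; apply: (phiP (fun y => A (x, y))).
by have := measurable_xsection x mA; rewrite xsectionE.
Qed.

End quasi_invariant_product.

Lemma quasi_invariant_comp d (T : measurableType d) (R : realType)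
    (P : probability T R) (a b : R) (phi psi : T -> T) :
  quasi_invariant P a phi -> quasi_invariant P b psi ->
  quasi_invariant P (a + b) (phi \o psi).
Proof.
move=> [mphi Pphi] [mpsi Ppsi]; split; first exact: measurableT_comp.
move=> A mA; rewrite EFinD addeA.
apply: le_trans (Ppsi _ (measurable_preimage mphi mA)) _.
by rewrite leeD2r// Pphi.
Qed.

(** Since [X] intertwines [phi] and [psi], pulling an event back by [psi] and then [X] is pulling it
    back by [X] and then [phi]. *)
Lemma quasi_invariant_distribution d d' (T : measurableType d)
    (T' : measurableType d') (R : realType) (P : probability T R)
    (X : {mfun T >-> T'}) (c : R) (phi : T -> T) (psi : T' -> T') :
  measurable_fun setT psi -> (forall x, X (phi x) = psi (X x)) ->
  quasi_invariant P c phi -> quasi_invariant (distribution P X) c psi.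
Proof.
move=> mpsi E [mphi Pphi]; split=> // A mA.
have := Pphi _ (measurable_preimage (measurable_funPT X) mA).
congr (P _ <= _)%E.
by apply/seteqP; split=> x /=; rewrite E.
Qed.

(** The head and the tail are moved one after the other, and the errors add. The maps are indexed by
    [nat] so that the induction can shift the index for the tail. *)
Lemma quasi_invariant_iid d (T : measurableType d) (R : realType)
    (P : probability T R) (c : R) (m : nat) (phi : nat -> T -> T) :
  0 <= c -> (forall i, quasi_invariant P c (phi i)) ->
  quasi_invariant (iid P m) (c *+ m)
    (fun t => [tuple phi i (tnth t i) | i < m]).
Proof.
move=> c0; elim: m phi => [|m IH] phi Pphi.
  split; last first.
    move=> A mA; rewrite mulr0n adde0 /=.
    rewrite (_ : _ @^-1` A = A)//; apply/seteqP.
    by split=> t /=; rewrite !(tuple0 t) !(tuple0 (mktuple _)).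
  by apply/measurable_fun_tnthP => -[].
have mt : measurable_fun setT
    (fun t : m.+1.-tuple T => [tuple phi i (tnth t i) | i < m.+1]).
  apply/measurable_fun_tnthP => i.
  rewrite (_ : _ \o _ = (phi i) \o (fun t => tnth t i)); last first.
    by apply/funext => t /=; rewrite tnth_mktuple.
  by apply: measurableT_comp; [exact: (Pphi i).1 | exact: measurable_tnth].
have := quasi_invariant_comp (quasi_invariant_fst (iid P m) c0 (Pphi 0%N))
  (quasi_invariant_snd P (mulrn_wge0 m c0)
    (IH (fun i => phi i.+1) (fun i => Pphi i.+1))).
rewrite -mulrS; apply: quasi_invariant_distribution => //.
move=> [x t] /=; apply: eq_from_tnth => i.
rewrite tnth_mktuple /tuple_cons/=.
case: (unliftP ord0 i) => [j|] -> //.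
by rewrite !tnthS tnth_mktuple /= /bump leq0n add1n.
Qed.

(** * Translations of the uniform law on an interval *)

Lemma uniform_probE (R : realType) (a b : R) (ab : a < b) (A : set R) :
  measurable A ->
  uniform_prob ab A =
    ((b - a)^-1%:E * lebesgue_measure (A `&` `[a, b]%classic))%E.
Proof.
move=> mA; rewrite /uniform_prob integral_uniform_pdf.
have mI : measurable (A `&` `[a, b]%classic) by exact: measurableI.
rewrite (eq_integral (fun=> (b - a)^-1%:E)); last first.
  by move=> x; rewrite inE/= in_itv/= /uniform_pdf => -[_ ->].
by rewrite integral_cst.
Qed.

Lemma measurable_translation (R : realType) (s : R) :
  measurable_fun [set: R] (fun x => x + s).
Proof. exact: measurable_funD. Qed.

(** The image of Lebesgue measure under the translation gives half-open intervals their length,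
    which characterizes Lebesgue measure. *)
Lemma lebesgue_measure_translate (R : realType) (s : R) (A : set R) :
  measurable A ->
  lebesgue_measure ((fun x => x + s) @^-1` A) = lebesgue_measure A.
Proof.
have mf : measurable_fun [set: measurableTypeR R]
    (fun x : R => x + s : measurableTypeR R).
  exact: measurable_translation.
pose nu : {measure set (measurableTypeR R) -> \bar R} :=
  measure_function_pushforward__canonical__measure_function_Measure
    lebesgue_measure mf.
move=> mA; apply/esym; apply: (@lebesgue_measure_unique R nu) => //.
move=> _ [[a b] _ <-]; rewrite /nu/= /pushforward.
rewrite (_ : _ @^-1` _ = `]a - s, b - s]%classic).
  rewrite !lebesgue_measure_itv/= !lte_fin ltrD2r; case: ifP => // _.
  by rewrite -!EFinB; congr (_%:E); ring.
by apply/seteqP; split=> x /=; rewrite !in_itv/= ltrBlDr lerBrDr.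
Qed.

Lemma quasi_invariant_uniform (R : realType) (N s : R) (NN : - N < N) :
  quasi_invariant (uniform_prob NN) (`|s| / (N + N)) (fun x => x + s).
Proof.
have N0 : 0 < N + N by move: NN; lra.
split=> [|A mA]; first exact: measurable_translation.
rewrite /= !uniform_probE//; last first.
  exact: measurable_preimage (measurable_translation s) mA.
rewrite opprK mulrC EFinM -ge0_muleDr// lee_wpmul2l//.
  by rewrite lee_fin invr_ge0 ltW.
rewrite (_ : _ `&` _ = (fun x => x + s) @^-1`
    (A `&` `[- N + s, N + s]%classic)); last first.
  by apply/seteqP; split=> x /=; rewrite !in_itv/= !lerD2r.
have mI a b : measurable (A `&` `[a, b]%classic) by exact: measurableI.
rewrite lebesgue_measure_translate; last exact: mI.
(* [J] has length [|s|] and covers what the translated interval has outside [[-N, N]]. *)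
pose J := (if 0 <= s then `]N, N + s]%classic
           else `[- N + s, - N[%classic) : set R.
have mJ : measurable J by rewrite /J; case: ifP.
have <- : lebesgue_measure J = `|s|%:E.
  rewrite /J; have [s0|s0] := leP 0 s; rewrite lebesgue_measure_itv/= lte_fin.
    rewrite -EFinB; case: ltP => h; rewrite ?ger0_norm//; congr (_%:E); lra.
  rewrite -EFinB; case: ltP => h; rewrite ?ltr0_norm//; congr (_%:E); lra.
apply: le_trans (measureU2 _ (mI _ _) mJ).
apply: le_measure; rewrite ?inE//; first exact: measurableU.
move=> x /= [Ax]; rewrite /J !in_itv/= => /andP[x1 x2].
have [s0|s0] := leP 0 s.
  have [xN|xN] := leP x N; [left|right].
    by split=> //; apply/andP; split; lra.
  by rewrite /= in_itv/= xN.
have [xN|xN] := leP (- N) x; [left|right].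
  by split=> //; apply/andP; split; lra.
by rewrite /= in_itv/= xN andbT.
Qed.

(** * The uniform law on a cube and self-correction *)

Lemma measurable_superlevel d (T : measurableType d) (R : realType)
    (f : T -> R) (c : R) :
  measurable_fun setT f -> measurable [set x | c < f x].
Proof.
by move=> mf; rewrite -preimage_itvoy; exact: measurable_preimage mf _.
Qed.

Lemma quasi_invariant_le d (T : measurableType d) (R : realType)
    (P : probability T R) (c c' : R) (phi : T -> T) :
  c <= c' -> quasi_invariant P c phi -> quasi_invariant P c' phi.
Proof.
move=> cc' [mphi Pphi]; split=> // A mA; apply: le_trans (Pphi A mA) _.
by rewrite leeD2l// lee_fin.
Qed.

Section cube_law.
Variables (R : realType) (n : nat).

Definition rV_of_tuple (t : n.-tuple (measurableTypeR R)) : 'rV[R]_n :=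
  \row_i tnth t i.

Let measurable_rV_of_tuple : measurable_fun setT rV_of_tuple.
Proof.
apply: measurable_fun_rV => i; under eq_fun do rewrite mxE.
exact: measurable_tnth.
Qed.

HB.instance Definition _ := isMeasurableFun.Build _ _ _ _
  rV_of_tuple measurable_rV_of_tuple.

Definition cube_law (N : R) (NN : - N < N) : probability 'rV[R]_n R :=
  distribution (iid (uniform_prob NN) n) rV_of_tuple.

(** The coordinates are independent, and translating each one by at most [s] costs at most
    [s / (N + N)]. *)
Lemma quasi_invariant_cube_law (N s c : R) (NN : - N < N) (p : 'rV[R]_n) :
  cube s p -> 0 <= s -> s / (N + N) *+ n <= c ->
  quasi_invariant (cube_law NN) c (fun x => x + p).
Proof.
move=> ps s0 sc.
have N0 : 0 < N + N by move: NN; lra.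
have c0 : 0 <= s / (N + N) by rewrite divr_ge0// ltW.
(* Extends the coordinates of [p] to all naturals; the default 0 respects the bound [s]. *)
pose v i := if insub i is Some j then p ord0 j else 0.
have vs i : `|v i| <= s by rewrite /v; case: insub => [j|]; rewrite ?ps ?normr0.
have q := @quasi_invariant_iid _ _ R (uniform_prob NN) _ n
  (fun i x => x + v i) c0 (fun i => quasi_invariant_le _
    (quasi_invariant_uniform (v i) NN)).
apply: quasi_invariant_le sc _; apply: quasi_invariant_distribution (q _).
- by apply: measurable_rV_add => //; exact: measurable_cst.
- by move=> t; apply/rowP => i; rewrite !mxE tnth_mktuple /v valK.
- by move=> i; rewrite ler_wpM2r// invr_ge0 ltW.
Qed.

End cube_law.

(** The events [k < |f|] decrease to the empty set, so their probabilities tend to 0. *)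
Lemma probability_norm_gt_le d (T : measurableType d) (R : realType)
    (P : probability T R) (f : T -> R) (e : R) : measurable_fun setT f ->
  0 < e -> exists B, (P [set x | (B < `|f x|)%R] <= e%:E)%E.
Proof.
move=> mf e0; apply: contrapT => /forallNP H.
pose F k := [set x | k%:R < `|f x|].
have mF k : measurable (F k).
  apply: measurable_superlevel; exact: measurableT_comp.
have F0 : \bigcap_k F k = set0.
  apply/seteqP; split=> // x Fx.
  have := Fx (Num.bound `|f x|) I.
  by rewrite /F/= ltNge (ltW (archi_boundP (normr_ge0 _))).
have cF : (P \o F) k @[k --> \oo] --> 0%E.
  rewrite -(measure0 P) -F0; apply: nonincreasing_cvg_mu => //.
  - by rewrite (le_lt_trans (probability_le1 _ _))// ltry.
  - by rewrite F0.
  - move=> i j ij; apply/subsetPset => x; rewrite /F/=; apply: le_lt_trans.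
    by rewrite ler_nat.
have : (e%:E <= 0 :> \bar R)%E.
  rewrite -(cvg_lim _ cF)//; apply: lime_ge; first by apply/cvg_ex; exists 0%E.
  by apply: nearW => k /=; have /negP := H k%:R; rewrite -ltNge => /ltW.
by rewrite lee_fin leNgt e0.
Qed.

Lemma exists_not_in3 d (T : measurableType d) (R : realType)
    (P : probability T R) (A B C : set T) (a b c : R) :
  measurable A -> measurable B -> measurable C ->
  (P A <= a%:E)%E -> (P B <= b%:E)%E -> (P C <= c%:E)%E -> a + b + c < 1 ->
  exists x, [/\ ~ A x, ~ B x & ~ C x].
Proof.
move=> mA mB mC Pa Pb Pc abc; apply: contrapT => /forallNP H.
have E : A `|` B `|` C = setT.
  apply/seteqP; split=> // x _; apply: contrapT => nx; apply: (H x).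
  by split=> h; apply: nx; [left; left|left; right|right].
have : (P (A `|` B `|` C) <= (a + b + c)%:E)%E.
  apply: le_trans (measureU2 _ _ mC) _; first exact: measurableU.
  rewrite !EFinD leeD//; apply: le_trans (measureU2 _ mA mB) _.
  by rewrite leeD.
by rewrite E probability_setT lee_fin leNgt abc.
Qed.

(** * Increments of [f] from a random base point *)

Section self_correction.
Variables (R : realType) (n : nat) (mu : probability 'rV[R]_n R).
Variables (f : 'rV[R]_n -> R) (mf : measurable_fun setT f).
Variables (a s : R) (a0 : 0 <= a) (s0 : 0 < s).

Definition violation : set ('rV[R]_n * 'rV[R]_n) :=
  [set z | a < `|f (z.1 + z.2) - f z.1 - f z.2|].

Lemma measurable_violation : measurable violation.
Proof.
apply: measurable_superlevel.
apply: measurableT_comp => //.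
apply: measurable_funB; last by apply: measurableT_comp.
apply: measurable_funB; last by apply: measurableT_comp.
by apply: measurableT_comp => //; exact: measurable_rV_add.
Qed.

Hypothesis mu_shift :
  forall p, cube s p -> quasi_invariant mu (1 / 80) (fun x => x + p).
Hypothesis few : ((mu \x mu) violation <= (1 / 80)%:E)%E.

Let spread (p : 'rV[R]_n) (b t : R) : set 'rV[R]_n :=
  [set x | b < `|f (x + p) - f x - t|].

Let measurable_shift (p : 'rV[R]_n) :
  measurable_fun setT (fun x : 'rV[R]_n => f (x + p)).
Proof.
by apply: measurableT_comp => //; apply: measurable_rV_add.
Qed.

Let measurable_spread p b t : measurable (spread p b t).
Proof.
apply: measurable_superlevel.
apply: measurableT_comp => //.
by apply: measurable_funB => //; apply: measurable_funB.
Qed.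

(* f(x + p) + f(y) and f(x) + f(y + p) both approximate f(x + y + p), so the
   increment of f along p is nearly independent of the base point. *)
Lemma increment_concentrated p : cube s p ->
  exists t, (mu (spread p (2 * a) t) <= (1 / 10)%:E)%E.
Proof.
move=> ps; pose g x := f (x + p) - f x.
pose W := [set z : 'rV[R]_n * 'rV[R]_n | 2 * a < `|g z.1 - g z.2|].
have mg : measurable_fun setT g by exact: measurable_funB.
have mW : measurable W.
  apply: measurable_superlevel.
apply: measurableT_comp => //.
  by apply: measurable_funB; apply: measurableT_comp.
suff W2 : ((mu \x mu) W < (1 / 10)%:E)%E.
  (* The typical increment is the one observed at a fixed base point [y] agreeing with most
     others. *)
  have [y Wy] := exists_ysection_le mW W2; exists (g y).
  by rewrite ysectionE in Wy.
have mS := measurable_violation.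
have [q1 q2] := (quasi_invariant_fst mu (divr_ge0 ler01 (ler0n R 80))
  (mu_shift ps), quasi_invariant_snd mu (divr_ge0 ler01 (ler0n R 80))
  (mu_shift ps)).
have m1 := measurable_preimage q1.1 mS.
have m2 := measurable_preimage q2.1 mS.
(* Two translated violation events, each costing 1/80 for the violations and 1/80 for the
   translation. *)
apply: (@le_lt_trans _ _ (1 / 80 + 1 / 80 + (1 / 80 + 1 / 80))%:E); last first.
  by rewrite lte_fin; lra.
set U := _ @^-1` violation in m1; set V := _ @^-1` violation in m2.
apply: (@le_trans _ _ ((mu \x mu)%E (U `|` V))).
  apply: le_measure; rewrite ?inE//; first exact: measurableU.
  move=> [x y]; rewrite /W /U /V /violation /g/= => xy.
  have E : x + (y + p) = x + p + y by rewrite addrA addrAC.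
  apply: contrapT => /not_orP[/negP + /negP]; rewrite E -!leNgt.
  move: xy; rewrite ltNge => /negP xy h1 h2; apply: xy; move: h1 h2.
  by rewrite !ler_norml; lra.
apply: le_trans (measureU2 _ m1 m2) _; rewrite EFinD leeD//.
  by apply: le_trans (q1.2 _ mS) _; rewrite EFinD leeD.
by apply: le_trans (q2.2 _ mS) _; rewrite EFinD leeD.
Qed.

(** Let [g p] be the typical increment along [p]. It is additive up to [6 * a] and bounded, hence
    within [36 * a] of a linear form; most increments lie within [2 * a] of [g p], which gives
    [38 * a]. *)
Lemma linear_self_correction : exists c : 'I_n -> R,
  forall p, cube (s / 2 ^+ n) p ->
    (mu [set x | (38 * a < `|f (x + p) - f x - \sum_i p ord0 i * c i|)%R]
      <= (1 / 10)%:E)%E.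
Proof.
have /choice[g gP] : forall p, exists t, cube s p ->
    (mu (spread p (2 * a) t) <= (1 / 10)%:E)%E.
  move=> p; have [ps|nps] := pselect (cube s p); last by exists 0.
  by have [t] := increment_concentrated ps; exists t.
have sum_lt1 : 1 / 10 + 1 / 10 + (1 / 10 + 1 / 80) < 1 :> R by lra.
(* At some [x], the increments along [p + q] and [q], and the one along [p] from [x + q], are all
   typical. The first is the sum of the others, so three errors [2 * a] add up. *)
have gD : additive_within s (6 * a) g.
  move=> p q ps qs pqs.
  have mC := measurable_preimage (mu_shift qs).1
    (measurable_spread p (2 * a) (g p)).
  have PC : (mu ((fun x => (x + q)%R) @^-1` spread p (2 * a) (g p))
      <= (1 / 10 + 1 / 80)%:E)%E.
    apply: le_trans ((mu_shift qs).2 _ (measurable_spread _ _ _)) _.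
    by rewrite EFinD leeD// gP.
  have [x [/negP + /negP + /negP]] := exists_not_in3 (measurable_spread _ _ _)
    (measurable_spread _ _ _) mC (gP _ pqs) (gP _ qs) PC sum_lt1.
  have -> : x + (p + q) = x + q + p by rewrite addrA addrAC.
  by rewrite -!leNgt !ler_norml; lra.
(* Measurability of [f] gives a bound [B], chosen before [p], valid off an event of probability
   1/10. Some [x] has a typical increment with [f x] and [f (x + p)] both bounded by [B]. *)
have gB : exists B, forall p, cube s p -> `|g p| <= B.
  have [B PB] := probability_norm_gt_le mu mf (ltac:(lra) : 0 < (1 / 10 : R)).
  exists (2 * B + 2 * a) => p ps.
  pose V := [set x | B < `|f x|].
  have mV : measurable V.
    by apply: measurable_superlevel; exact: measurableT_comp.
  have mC := measurable_preimage (mu_shift ps).1 mV.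
  have PC : (mu ((fun x => (x + p)%R) @^-1` V) <= (1 / 10 + 1 / 80)%:E)%E.
    by apply: le_trans ((mu_shift ps).2 _ mV) _; rewrite EFinD leeD.
  have [x [/negP + /negP + /negP]] := exists_not_in3 (measurable_spread _ _ _)
    mV mC (gP _ ps) PB PC sum_lt1.
  by rewrite -!leNgt !ler_norml; lra.
have a6 : 0 <= 6 * a by rewrite mulr_ge0.
have [c cP] := additive_within_linear s0 a6 gD gB.
exists c => p ps; set L := \sum_i _.
have ps' : cube s p.
  apply: sub_cube ps; have n0 : (0 : R) < 2 ^+ n by rewrite exprn_gt0.
  by rewrite ler_pdivrMr// ler_peMr ?(ltW s0)// exprn_ege1// ler1n.
apply: le_trans (gP p ps'); apply: le_measure; rewrite ?inE.
- exact: (measurable_spread p (38 * a) L).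
- exact: measurable_spread.
move=> x; rewrite /spread /= !ltNge => /negP h; apply/negP => h'; apply: h.
have := cP p ps; move: h'; rewrite -/L !ler_norml; lra.
Qed.

End self_correction.

(** * The tester *)

Section check_tree.
Variables (V Y : zmodType) (ok : pred Y).

Fixpoint check_tree (l : seq (V * V)) : query_tree V Y :=
  if l is z :: l' then
    Query (z.1 + z.2) (fun u => Query z.1 (fun v => Query z.2 (fun w =>
      if ok (u - v - w) then check_tree l' else Output V Y false)))
  else Output V Y true.

Lemma accepts_check_tree (f : V -> Y) l : accepts f (check_tree l) =
  all (fun z => ok (f (z.1 + z.2) - f z.1 - f z.2)) l.
Proof. by elim: l => //= z l <-; case: ifP. Qed.

Lemma queries_check_tree (f : V -> Y) l :
  (queries f (check_tree l) <= 3 * size l)%N.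
Proof.
elim: l => //= z l IH; rewrite mulnS !addSn add0n !ltnS.
by case: ifP.
Qed.

End check_tree.

Lemma measurable_forall_ord d (T : measurableType d) (k : nat)
    (F : 'I_k -> set T) :
  (forall i, measurable (F i)) -> measurable [set x | forall i, F i x].
Proof.
move=> mF; rewrite [X in measurable X](_ : _ = \bigcap_(i in [set: 'I_k]) F i).
  exact: fin_bigcap_measurable.
by apply/seteqP; split=> x /= H i => [_|]; exact: H.
Qed.

Section iid_bounds.
Context d (T : measurableType d) (R : realType).
Variable P : probability T R.

Lemma iid_all_le (m : nat) (B : set T) (b : R) : measurable B ->
  (P B <= b%:E)%E ->
  (iid P m [set t | forall i, B (tnth t i)] <= (b ^+ m)%:E)%E.
Proof.
move=> mB Pb; rewrite (iid_rect P (B := fun=> B))//.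
have b0 : 0 <= b by rewrite -lee_fin (le_trans _ Pb).
elim: m => [|m IH]; first by rewrite big_ord0 expr0.
rewrite big_ord_recl exprS EFinM lee_pmul//.
by apply: prode_ge0 => i _.
Qed.

End iid_bounds.

(** The product [(1 - q) ^+ m * (1 + m q)] does not increase with [m]. This decay suffices because
    only constant failure probabilities are sought. *)
Lemma exprn_bernoulli (R : realType) (q : R) (m : nat) : 0 <= q -> q <= 1 ->
  (1 - q) ^+ m <= (1 + m%:R * q)^-1.
Proof.
move=> q0 q1; have p0 k : 0 < 1 + k%:R * q :> R.
  by rewrite ltr_pwDl// mulr_ge0.
rewrite -[leRHS]mul1r ler_pdivlMr//.
elim: m => [|m IH]; first by rewrite expr0 mul0r addr0 mulr1.
have x0 : 0 <= (1 - q) ^+ m by rewrite exprn_ge0// subr_ge0.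
apply: le_trans IH; rewrite exprSr -mulrA ler_wpM2l//.
have := mulr_ge0 (ler0n R m) (mulr_ge0 q0 q0); rewrite -[m.+1%:R]natr1.
have -> : (1 - q) * (1 + (m%:R + 1) * q) =
  1 + m%:R * q - m%:R * (q * q) - q * q by ring.
by have := mulr_ge0 q0 q0; lra.
Qed.

Section additivity_tester.
Variables (R : realType) (n : nat) (mu : probability 'rV[R]_n R).
Variables (a : R) (k m : nat).

Let V := 'rV[R]_n.

Definition pairs_to_check (w : k.-tuple (V * V) * V * m.-tuple V) :=
  w.1.1 ++ [seq (w.1.2, p) | p <- w.2].

Definition additivity_run (w : k.-tuple (V * V) * V * m.-tuple V) :
    query_tree V R :=
  check_tree (fun d => `|d| <= a) (pairs_to_check w).

Lemma accepts_additivity_run (f : V -> R) w :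
  accepts f (additivity_run w) <->
  (forall i, ~ violation f a (tnth w.1.1 i)) /\
  (forall j, ~ violation f a (w.1.2, tnth w.2 j)).
Proof.
rewrite /violation /= accepts_check_tree all_cat all_map; split.
  move=> /andP[/all_tnthP H1 /all_tnthP H2].
  split=> i /=; [have := H1 i|have := H2 i] => /= h; apply/negP.
    by rewrite -leNgt.
  by rewrite -leNgt.
move=> [H1 H2]; apply/andP; split; apply/all_tnthP => i /=; rewrite leNgt;
  apply/negP; [exact: H1|exact: H2].
Qed.

Lemma measurable_additivity_run (f : V -> R) : measurable_fun setT f ->
  measurable [set w | accepts f (additivity_run w)].
Proof.
move=> mf.
have mS := measurableC (measurable_violation mf a).
rewrite [X in measurable X](_ : _ =
  [set w | forall i, (~` violation f a) (tnth w.1.1 i)] `&`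
  [set w | forall j, (~` violation f a) (w.1.2, tnth w.2 j)]); last first.
  by apply/seteqP; split=> w /accepts_additivity_run.
apply: measurableI; apply: measurable_forall_ord => i.
- apply: (measurable_preimage _ mS).
  apply: (measurableT_comp (measurable_tnth i)).
  exact: (measurableT_comp measurable_fst measurable_fst).
- apply: (measurable_preimage _ mS); apply: measurable_fun_pair.
    exact: (measurableT_comp measurable_snd measurable_fst).
  exact: (measurableT_comp (measurable_tnth i) measurable_snd).
Qed.

Definition additivity_tester : tester R n :=
  @Tester R n _ _ (iid (mu \x mu)%E k \x mu)%E m additivity_run
    measurable_additivity_run.

End additivity_tester.

(** Lets a necessary condition for acceptance, of easily bounded probability, stand in for
    acceptance itself. *)
Lemma reject_prob_ge (R : realType) (n : nat) (T : tester R n)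
    (D : probability 'rV[R]_n R) (f : 'rV[R]_n -> R)
    (E : set (tester_space T * (nsamples T).-tuple 'rV[R]_n)) (c : R) :
  measurable_fun setT f -> measurable E ->
  (forall w, accepts f (tester_run T w) -> E w) ->
  (run_law T D E <= c%:E)%E -> ((1 - c)%:E <= reject_prob T D f)%E.
Proof.
move=> mf mE accE Ec; apply: (@le_trans _ _ (run_law T D (~` E))).
  rewrite probability_setC// EFinB leeB//.
apply: le_measure; rewrite ?inE.
- exact: measurableC.
- rewrite (_ : [set w | _] = ~` [set w | accepts f (tester_run T w)]).
    exact: measurableC (measurable_tester_run mf).
  by apply/seteqP; split=> w /= /negP.
- by move=> w /= nE; apply/negP => /accE.
Qed.

(** * Lower bounds on the rejection probability *)

Section rejection.
Variables (R : realType) (n : nat) (mu D : probability 'rV[R]_n R).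
Variables (f : 'rV[R]_n -> R) (mf : measurable_fun setT f).
Variables (a : R) (k m : nat).

Let T := additivity_tester mu a k m.
Let S := violation f a.

Let mS : measurable (~` S).
Proof. exact: measurableC (measurable_violation mf a). Qed.

Lemma reject_prob_many_violations (b : R) :
  ((mu \x mu) (~` S) <= b%:E)%E -> ((1 - b ^+ k)%:E <= reject_prob T D f)%E.
Proof.
move=> Sb; pose A := [set t : k.-tuple _ | forall i, (~` S) (tnth t i)].
have mA : measurable A.
  by apply: measurable_forall_ord => i;
    exact: measurable_preimage (measurable_tnth i) mS.
apply: (@reject_prob_ge R n T D f ((A `*` setT) `*` setT)) => //.
- by apply: measurableX => //; exact: measurableX.
- by move=> w /accepts_additivity_run[].
rewrite [leLHS]product_measureXT; last exact: measurableX.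
by rewrite [leLHS]product_measureXT//; exact: iid_all_le.
Qed.

(** All samples miss [G] with probability at most [b ^+ m]. Otherwise one sample in [G] is kept; the
    point drawn from [mu] is independent of it, and fails to form a violation with it with
    probability at most [c]. *)
Lemma reject_prob_heavy_set (G : set 'rV[R]_n) (b c : R) : measurable G ->
  0 <= c -> (D (~` G) <= b%:E)%E ->
  (forall p, G p -> (mu [set x | (~` S) (x, p)] <= c%:E)%E) ->
  ((1 - (b ^+ m + c))%:E <= reject_prob T D f)%E.
Proof.
move=> mG c0 Gb Gc.
pose E := [set w : k.-tuple ('rV[R]_n * 'rV[R]_n) * 'rV[R]_n *
  m.-tuple 'rV[R]_n | forall j, (~` S) (w.1.2, tnth w.2 j)].
have mE : measurable E.
  apply: measurable_forall_ord => i.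
  apply: (measurable_preimage _ mS); apply: measurable_fun_pair.
    exact: (measurableT_comp measurable_snd measurable_fst).
  exact: (measurableT_comp (measurable_tnth i) measurable_snd).
have mSp p : measurable [set x | (~` S) (x, p)].
  by have := measurable_ysection p mS; rewrite ysectionE.
pose B := [set t : m.-tuple _ | forall j, (~` G) (tnth t j)].
have mB : measurable B.
  by apply: measurable_forall_ord => i;
    exact: measurable_preimage (measurable_tnth i) (measurableC mG).
apply: (@reject_prob_ge R n T D f E) => //.
  by move=> w /accepts_additivity_run[].
apply: (@le_trans _ _ (run_law T D (setT `*` B) + c%:E)%E); last first.
  rewrite EFinD leeD2r// [leLHS]product_measureTX//.
  exact: iid_all_le (measurableC mG) Gb.
apply: product_le_ysection => //; first exact: measurableX.
move=> t; rewrite (_ : ysection E t = setT `*`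
    [set x | forall j, (~` S) (x, tnth t j)]); last first.
  by apply/seteqP; split=> z; [move/ysectionP|case=> _ Xz; apply/ysectionP].
have mX : measurable [set x | forall j, (~` S) (x, tnth t j)].
  by apply: measurable_forall_ord => j; exact: mSp.
rewrite [leLHS]product_measureTX//.
(* With the samples [t] fixed: if all of them miss [G], the right-hand section is the whole space
   and the bound is trivial. *)
have [Bt|] := pselect (B t).
  rewrite (_ : ysection _ t = setT).
    rewrite probability_setT (le_trans (probability_le1 _ _))//.
    by rewrite leeDl// lee_fin.
  by apply/seteqP; split=> // z _; apply/ysectionP.
move=> /existsNP[j /contrapT Gj].
apply: (@le_trans _ _ c%:E); last by rewrite leeDr// measure_ge0.
apply: le_trans (Gc _ Gj); apply: le_measure; rewrite ?inE//.
by move=> x; apply.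
Qed.

End rejection.

(** * Euclidean balls, the logarithmic bound and the choice of constants *)

Lemma norm2_cube (R : realType) (n : nat) (p : 'rV[R]_n) (r : R) :
  norm2 p < r -> cube r p.
Proof.
move=> pr i; apply: le_trans (ltW pr).
have pos (P : pred 'I_n) : 0 <= \sum_(j | P j) p ord0 j ^+ 2.
  by apply: sumr_ge0 => j _; exact: sqr_ge0.
by rewrite -sqrtr_sqr /norm2 ler_sqrt// (bigD1 i)//= lerDl.
Qed.

Lemma measurable_norm2_lt (R : realType) (n : nat) (r : R) :
  measurable [set p : 'rV[R]_n | norm2 p < r].
Proof.
have mc i : measurable_fun setT (fun p : 'rV[R]_n => p ord0 i ^+ 2).
  exact: measurable_funX (measurable_coord i).
rewrite -preimage_itvNyo; apply: measurable_preimage => //.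
have msqrt : measurable_fun [set: R] (@Num.sqrt R).
  by apply: continuous_measurable_fun; exact: sqrt_continuous.
exact: (measurableT_comp msqrt (measurable_sum _ mc)).
Qed.

(** Up to [expR 1] the term 1 suffices, and beyond it [ln y >= 1]. With [y = eps^-1], this turns a
    number of queries linear in [1 / eps] into the stated form. *)
Lemma inv_le_max_inv_ln (R : realType) (y : R) : 0 < y ->
  y <= expR 1 * Num.max 1 (y * ln y).
Proof.
move=> y0; have e1 : 1 <= expR 1 :> R by rewrite -expR0 ler_expR.
have [ye|ey] := leP y (expR 1).
  by rewrite -[leLHS]mulr1 ler_pM ?(ltW y0)// le_max lexx.
have ly : 1 <= ln y by rewrite -ler_expR lnK// ltW.
rewrite (@le_trans _ _ (expR 1 * y))//; first by rewrite ler_peMl// ltW.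
by rewrite ler_wpM2l ?expR_ge0// le_max ler_peMr ?orbT// ltW.
Qed.

Unset Implicit Arguments.

Theorem theoremD1 (R : realType) :
  exists C K : R, 0 < C /\ 0 < K /\
  forall (n : nat) (alpha eps r : R),
    (0 < n)%N -> 0 < alpha -> 0 < eps -> 1 <= r * n%:R `^ (3 / 2) ->
  exists T : tester R n,
    (forall w (f : 'rV[R]_n -> R),
      (queries f (tester_run T w))%:R <=
        K * Num.max 1 (eps^-1 * ln eps^-1)) /\
    (forall D : probability 'rV[R]_n R, concentrated (eps / 4) r D ->
      (forall f : 'rV[R]_n -> R,
        (exists2 h, additive_fun h & pointwise_close alpha f h) ->
        accepts_as T D f) /\
      (forall f : 'rV[R]_n -> R, measurable_fun setT f ->
        far_from_additive eps (C * r * n%:R `^ (3 / 2) * alpha) D f ->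
        ((2 / 3)%:E <= reject_prob T D f)%E)).
Proof.
(* From [3 * (160 + m)] queries with [m <= 12 / eps + 1]: 483 is [3 * 161], and [36 / eps] is at
   most [36 * expR 1] times the maximum. *)
pose K : R := 483 + 36 * expR 1.
exists 117, K; split=> //; split.
  by rewrite addr_gt0// mulr_gt0// expR_gt0.
move=> n alpha eps r n0 alpha0 eps0 rn.
have r0 : 0 < r.
  rewrite ltNge; apply/negP => r0.
  have := mulr_le0_ge0 r0 (powR_ge0 n%:R (3 / 2)); move: rn; lra.
pose s := 2 ^+ n * r.
have s0 : 0 < s by rewrite mulr_gt0// exprn_gt0.
have nR : (0 : R) < n%:R by rewrite ltr0n.
(* Makes the translation cost [n s / (2 N)] equal to 1/80. *)
pose N := 40 * s * n%:R.
have N0 : 0 < N by rewrite !mulr_gt0.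
have NN : - N < N by lra.
have sN : s / (N + N) *+ n <= 1 / 80.
  rewrite -mulr_natr /N (_ : s / _ * _ = 1 / 80)//.
  by field; rewrite gt_eqF// addr_gt0.
have sr : s / 2 ^+ n = r by rewrite /s mulrC mulKf// gt_eqF// exprn_gt0.
pose mu := @cube_law R n N NN.
pose a := 3 * alpha.
have a0 : 0 <= a by rewrite mulr_ge0// ltW.
(* The successor ensures [m * eps >= 12], so that [1 + m * (3 * eps / 4) >= 10]. *)
pose m := (Num.truncn (12 / eps)).+1.
exists (additivity_tester mu a 160 m); split.
  move=> w f.
  have y0 : 0 < eps^-1 by rewrite invr_gt0.
  have := inv_le_max_inv_ln y0; set M := Num.max _ _ => yM.
  have M1 : 1 <= M by rewrite le_max lexx.
  have mle : m%:R <= 12 / eps + 1.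
    by rewrite /m -[leLHS]natr1 lerD2r truncn_le// divr_ge0// ltW.
  have q : (queries f (additivity_run a w) <= 3 * (160 + m))%N.
    apply: leq_trans (queries_check_tree _ _ _) _.
    by rewrite size_cat size_map !size_tuple.
  apply: (@le_trans _ _ (3 * (160 + m))%:R); first by rewrite ler_nat.
  have -> : K * M = 483 * M + 36 * (expR 1 * M) by rewrite /K; ring.
  by rewrite natrM natrD; lra.
move=> D conc; split.
  (* Every outcome is accepted: the values of [h] cancel, and three errors [alpha] make up [a]. *)
  move=> f [h hD fh]; apply: aeW => w; apply/accepts_additivity_run.
  have ok z : ~ violation f a z.
    rewrite /violation /=; apply/negP; rewrite -leNgt.
    have := fh (z.1 + z.2); have := fh z.1; have := fh z.2.
    by rewrite hD /a !ler_norml; lra.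
  by split=> i; exact: ok.
move=> f mf far.
have mS := measurable_violation mf a.
have mu_shift p : cube s p -> quasi_invariant mu (1 / 80) (fun x => x + p).
  by move=> ps; exact: quasi_invariant_cube_law ps (ltW s0) sN.
have [few|many] := leP ((mu \x mu) (violation f a))%E (1 / 80)%:E; last first.
  apply: le_trans (@reject_prob_many_violations R n mu D f mf a 160 m
    (1 - 1 / 80) _).
    (* All 160 pairs pass with probability at most [1 / (1 + 160 / 80) = 1 / 3]. *)
    have : (0 : R) <= 1 / 80 by lra.
    move=> /exprn_bernoulli -/(_ 160%N ltac:(lra)) b.
    by rewrite lee_fin; lra.
  by rewrite [leLHS]probability_setC// EFinB leeB// ltW.
have [c cP] := linear_self_correction mf a0 s0 mu_shift few.
rewrite sr in cP.
pose L (p : 'rV[R]_n) := \sum_i p ord0 i * c i.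
have LD : additive_fun L.
  move=> x y; rewrite -big_split/=.
  by apply: eq_bigr => i _; rewrite mxE mulrDl.
have mL : measurable_fun setT L.
  apply: measurable_sum => i; apply: measurable_funM => //.
  exact: measurable_coord.
pose t := 117 * r * n%:R `^ (3 / 2) * alpha.
(* This fixes the constant: [39 * a] is [117 * alpha], and [r * n^(3/2)] is at least 1. *)
have le_t : 39 * a <= t.
  have : 117 * alpha * 1 <= 117 * alpha * (r * n%:R `^ (3 / 2)).
    by rewrite ler_wpM2l// mulr_ge0// ltW.
  have -> : 117 * alpha * (r * n%:R `^ (3 / 2)) = t by rewrite /t; ring.
  by rewrite /a; lra.
pose Far := [set p | t < `|f p - L p|].
have mFar : measurable Far.
  apply: measurable_superlevel.
  by apply: measurableT_comp => //; exact: measurable_funB.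
have DFar := far L LD mFar.
have eps1 : eps < 1.
  by rewrite -lte_fin (lt_le_trans DFar)// probability_le1.
pose G := [set p : 'rV[R]_n | norm2 p < r] `&` Far.
have mball := @measurable_norm2_lt R n r.
have mG : measurable G by exact: measurableI.
(* Concentration removes at most [eps / 4] from the mass [eps] of [Far]. *)
have DG : (D (~` G) <= (1 - 3 * eps / 4)%:E)%E.
  rewrite /G setCI; apply: le_trans (measureU2 _ _ _) _.
  - exact: measurableC.
  - exact: measurableC.
  rewrite (_ : 1 - 3 * eps / 4 = eps / 4 + (1 - eps)); last by field.
  have Ball : (D (~` [set p : 'rV[R]_n | norm2 p < r]%R) <= (eps / 4)%:E)%E.
    rewrite (_ : eps / 4 = 1 - (1 - eps / 4)); last by ring.
    by rewrite [leLHS]probability_setC// EFinB leeB.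
  have Near : (D (~` Far) <= (1 - eps)%:E)%E.
    by rewrite [leLHS]probability_setC// EFinB leeB// ltW.
  by rewrite EFinD leeD.
have c0 : (0 : R) <= 1 / 10 by lra.
apply: le_trans (@reject_prob_heavy_set R n mu D f mf a 160 m G
  (1 - 3 * eps / 4) (1 / 10) mG c0 DG _).
  (* Both failure probabilities are at most 1/10, which leaves 4/5, more than 2/3. *)
  rewrite lee_fin; have q0 : 0 <= 3 * eps / 4 by lra.
  have q1 : 3 * eps / 4 <= 1 by lra.
  have := exprn_bernoulli m q0 q1.
  suff : (1 + m%:R * (3 * eps / 4))^-1 <= 1 / 10 by lra.
  rewrite div1r lef_pV2 ?posrE//; last by rewrite ltr_pwDl// mulr_ge0.
  have : 12 / eps * eps <= m%:R * eps by rewrite ler_wpM2r ?ltW// truncnS_gt.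
  by rewrite divfK ?gt_eqF//; lra.
move=> p [pr pFar]; apply: le_trans (cP p (norm2_cube pr)).
apply: le_measure; rewrite ?inE.
- by have := measurable_ysection p (measurableC mS); rewrite ysectionE.
- apply: measurable_superlevel; apply: measurableT_comp => //.
  apply: measurable_funB => //; apply: measurable_funB => //.
  by apply: measurableT_comp => //; exact: measurable_rV_add.
(* Without a violation, the increment at [x] is within [a] of [f p], hence more than
   [t - a >= 38 * a] away from [L p]. *)
move=> x; rewrite /violation /= => /negP; rewrite -leNgt -/(L p).
move: pFar; rewrite /Far /= !ltNge => /negP h1 h2; apply/negP => h3.
by apply: h1; move: le_t h2 h3; rewrite !ler_norml; lra.
Qed.
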